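(* Let $N\ge 1$ be an integer. There exists $T>0$ (depending on $N$) such that for all real $t>T$: (i) all zeros of the polynomial $x\mapsto q_N(x;t)$, which has degree $N$ in $x$, are real and simple; (ii) moreover, all zeros of $x\mapsto q_{N+1}(x;t)$ are real and simple, and the zeros of $x\mapsto q_N(x;t)$ and of $x\mapsto q_{N+1}(x;t)$ interlace, i.e. writing $\beta_1^N<\dots<\beta_N^N$ for the zeros of $q_N(\cdot;t)$ and $\beta_1^{N+1}<\dots<\beta_{N+1}^{N+1}$ for those of $q_{N+1}(\cdot;t)$, $$\beta_1^{N+1}<\beta_1^N<\beta_2^{N+1}<\beta_2^N<\dots<\beta_N^{N+1}<\beta_N^N<\beta_{N+1}^{N+1}.$$
   Context: Let $(a_n)_{n\ge0}$, $(b_n)_{n\ge0}$, $(c_n)_{n\ge1}$ be real sequences with $a_n\neq 0$ for all $n\ge0$ and $a_{n-1}c_n>0$ for all $n\ge1$. The polynomials $p_n$ (of degree $n$) are determined by $x\,p_n(x)=a_n p_{n+1}(x)+b_n p_n(x)+c_n p_{n-1}(x)$ for $n\ge 0$, with $p_{-1}(x)=0$, $p_0(x)=1$ (the term $c_0p_{-1}$ being zero). By Favard's theorem the $p_n$ are orthogonal with respect to a positive measure on $\mathbb{R}$. Let $(\alpha_n)_{n\ge0}$ be a sequence of nonzero real numbers with $\alpha_0=1$, and put $q_m(x;t)=\sum_{n=0}^m t^n\alpha_n p_n(x)$. *)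

(* Defs.v *)
From HB Require Import structures.
From mathcomp Require Import all_boot all_order all_algebra.
From mathcomp Require Import reals.
From mathcomp Require Import complex.

Set Implicit Arguments.
Unset Strict Implicit.
Unset Printing Implicit Defensive.

Import Order.TTheory GRing.Theory Num.Theory.

Local Open Scope ring_scope.

(* The case n = 0 encodes the convention p_{-1} = 0, so [c 0] is never used. *)
Definition three_term_recurrence (R : realType) (a b c : nat -> R)
    (p : nat -> {poly R}) : Prop :=
  p 0%N = 1 /\
  forall n : nat,
    'X * p n = a n *: p n.+1 + b n *: p n
               + (if n is m.+1 then c n *: p m else 0).

Definition genpoly (R : realType) (alpha : nat -> R) (p : nat -> {poly R})
    (m : nat) (t : R) : {poly R} :=
  \sum_(n < m.+1) (t ^+ n * alpha n) *: p n.

(* The zeros range over the complex numbers R[i]; [mup z] is the multiplicity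
   of [z] as a zero. *)
Definition real_simple_zeros (R : realType) (q : {poly R}) : Prop :=
  let qC : {poly R[i]} := map_poly (real_complex R) q in
  forall z : R[i], root qC z -> z \is Num.real /\ mup z qC = 1%N.

Definition increasing_zeros (R : realType) (q : {poly R}) (s : seq R) : Prop :=
  sorted <%R s /\ (forall x : R, root q x <-> x \in s).

(* Indices start at 0: [s`_i] is the (i+1)-st zero. *)
Definition interlace (R : realType) (s s' : seq R) : Prop :=
  size s' = (size s).+1 /\
  forall i : nat, (i < size s)%N -> s'`_i < s`_i /\ s`_i < s'`_i.+1.

(* Main.v *)
Require Import Defs.
From HB Require Import structures.
From mathcomp Require Import all_boot all_order all_algebra.
From mathcomp Require Import reals.
From mathcomp Require Import complex.
From mathcomp Require Import polyrcf ring lra.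

Set Implicit Arguments.
Unset Strict Implicit.
Unset Printing Implicit Defensive.

Import Order.TTheory GRing.Theory Num.Theory.

Local Open Scope ring_scope.

(** Everything is reduced to sign patterns of monic polynomials at increasing
    lists of points.  Say that q alternates along s_0 < ... < s_k when q is
    positive at s_k and its sign flips from each point to the previous one.

    A monic polynomial of degree k alternating along k + 1 points has, by the
    intermediate value theorem, one zero in each gap, hence no other zero
    ([zeros_in_gaps]).  If instead q is monic of degree k + 1 and - q alternates
    along k points, then the signs of q at both infinities supply two more
    points, so that the zeros of q surround and separate the given ones
    ([zeros_around]).  Conversely two interlacing lists force the monic
    polynomials vanishing on them to alternate along each other
    ([alternates_prod_inner], [alternates_prod_outer]).

    After rescaling, the p_n become monic polynomials P_n with
    P_(n+2) = (x - b_(n+1)) P_(n+1) - a_n c_(n+1) P_n, where the last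
    coefficient is positive.  At the zeros of P_(n+1) the signs of P_(n+2) and
    P_n are thus opposite, and induction shows that P_N alternates along the
    zeros s of P_(N+1) ([alternates_monic_recurrence]).

    Write Q_m for q_m(.; t) divided by its leading coefficient.  At each of the
    finitely many points of s, q_N(.; t) is a polynomial in t dominated for
    large t by t^N alpha_N p_N; hence Q_N alternates along s as well
    ([eventually_alternates_genpoly]) and has simple real zeros beta that
    interlace with s.  Finally Q_(N+1) differs from P_(N+1) by a multiple of
    Q_N, so both take the same values on beta.  Since beta interlaces with the
    zeros of P_(N+1), - Q_(N+1) alternates along beta, and [zeros_around] gives
    the zeros of Q_(N+1) with the required interlacing. *)

(** * Alternating signs and interlacing lists *)

(** The exponent is normalised so that [q] is positive at the last point, which
    is the pattern of a monic polynomial separated by [s]. *)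
Definition alternates (R : realType) (q : {poly R}) (s : seq R) : Prop :=
  forall i : nat, (i < size s)%N -> 0 < (-1) ^+ (size s + i.+1) * q.[s`_i].

Definition prod_XsubC (R : realType) (s : seq R) : {poly R} :=
  \prod_(x <- s) ('X - x%:P).

Lemma interlace_sorted_inner (R : realType) (s s' : seq R) :
  interlace s s' -> sorted <%R s.
Proof.
move=> [_ h]; apply/(sortedP 0) => i lti.
by apply: lt_trans (proj2 (h i (ltnW lti))) (proj1 (h _ lti)).
Qed.

Lemma interlace_sorted_outer (R : realType) (s s' : seq R) :
  interlace s s' -> sorted <%R s'.
Proof.
move=> [sz h]; apply/(sortedP 0) => i; rewrite sz ltnS => lti.
by apply: lt_trans (proj1 (h i lti)) (proj2 (h i lti)).
Qed.

(** Each of the [size s - k] roots beyond [z] contributes one negative factor. *)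
Lemma sign_prod_XsubC (R : realType) (s : seq R) (z : R) (k : nat) :
    (k <= size s)%N ->
    (forall j, (j < k)%N -> s`_j < z) ->
    (forall j, (k <= j < size s)%N -> z < s`_j) ->
  0 < (-1) ^+ (size s + k) * (prod_XsubC s).[z].
Proof.
rewrite /prod_XsubC.
elim: s k => [|x s IH] k.
  by rewrite leqn0 => /eqP ->; rewrite big_nil hornerC mulr1 expr0.
rewrite big_cons hornerM hornerXsubC.
case: k => [_ _ gt_z|k le_k lt_z gt_z].
- have zx := gt_z 0%N isT; rewrite /= in zx.
  have := IH 0%N isT (fun j (hj : (j < 0)%N) => ltac:(by [])) (fun j hj => gt_z j.+1 hj).
  by rewrite /= !addn0 exprS; nra.
- have zx := lt_z 0%N isT; rewrite /= in zx.
  have := IH k le_k (fun j hj => lt_z j.+1 hj) (fun j hj => gt_z j.+1 hj).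
  by rewrite /= addSn addnS !exprS; nra.
Qed.

(** Exactly [i] elements of [s] lie below [s'`_i]. *)
Lemma alternates_prod_inner (R : realType) (s s' : seq R) :
  interlace s s' -> alternates (prod_XsubC s) s'.
Proof.
move=> ss' i lti; have [sz h] := ss'.
have mono := lt_sorted_leq_nth 0 (interlace_sorted_outer ss').
have lei : (i <= size s)%N by rewrite -ltnS -sz.
rewrite sz addSn addnS -signr_odd /= negbK signr_odd.
apply: sign_prod_XsubC => // [j ltj|j /andP[lej ltj]].
- apply: lt_le_trans (proj2 (h j (leq_trans ltj lei))) _.
  by rewrite mono ?inE ?sz ?ltnS // (leq_trans ltj lei).
- apply: le_lt_trans (proj1 (h j ltj)).
  by rewrite mono ?inE ?sz ?ltnS // ltnW.
Qed.

(** Exactly [i.+1] elements of [s'] lie below [s`_i]; the extra element of [s']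
    beyond the last point of [s] is what causes the opposite sign. *)
Lemma alternates_prod_outer (R : realType) (s s' : seq R) :
  interlace s s' -> alternates (- prod_XsubC s') s.
Proof.
move=> ss' i lti; have [sz h] := ss'.
have mono := lt_sorted_leq_nth 0 (interlace_sorted_outer ss').
rewrite hornerN mulrN -mulNr -mulN1r -exprS -addSn -sz.
apply: sign_prod_XsubC => [|j|j /andP[lej ltj]]; first by rewrite sz ltnW.
- rewrite ltnS => lej; apply: le_lt_trans (proj1 (h i lti)).
  by rewrite mono ?inE ?sz ?ltnS ?(leq_trans lej) // ltnW.
- apply: lt_le_trans (proj2 (h i lti)) _.
  by rewrite mono ?inE ?ltj // sz ltnS.
Qed.

(** * Zeros forced by alternating signs *)

(** The intermediate value theorem gives one zero per gap, and there are as many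
    gaps as the degree allows zeros; so these zeros are simple and are the only
    ones, even over an extension field. *)
Lemma zeros_in_gaps (R : realType) (q : {poly R}) (s : seq R) :
    q \is monic -> size q = size s -> sorted <%R s -> alternates q s ->
  exists2 beta, interlace beta s & q = prod_XsubC beta.
Proof.
move=> qmonic szq s_sorted alt.
have /lt0n_neq0 : (0 < size q)%N by rewrite size_poly_gt0 monic_neq0.
case szs: (size s) => [|n]; first by rewrite szq szs.
move=> _.
have zero_in i : {x | (i < n)%N -> s`_i < x < s`_i.+1 /\ root q x}.
  case: (ltnP i n) => [lti|_]; last by exists 0.
  have lt_s : s`_i < s`_i.+1 by move/(sortedP 0): s_sorted; apply; rewrite szs.
  have neg : q.[s`_i] * q.[s`_i.+1] < 0.
    have h1 : 0 < (-1) ^+ (size s + i.+1) * q.[s`_i].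
      by apply: alt; rewrite szs ltnS ltnW.
    have h2 : 0 < (-1) ^+ (size s + i.+2) * q.[s`_i.+1].
      by apply: alt; rewrite szs ltnS.
    move: (mulr_gt0 h1 h2); rewrite (addnS _ i.+1) exprS.
    rewrite mulN1r mulNr mulrN mulrACA -expr2 sqrr_sign mul1r.
    by rewrite oppr_gt0.
  have [x + rx] := poly_ivtoo (ltW lt_s) neg.
  by rewrite in_itv /= => xs; exists x.
pose beta := mkseq (fun i => sval (zero_in i)) n.
have szb : size beta = n by rewrite size_mkseq.
have betaP i : (i < n)%N -> s`_i < beta`_i < s`_i.+1 /\ root q beta`_i.
  by move=> lti; rewrite nth_mkseq //; case: (zero_in i) => x /= /(_ lti).
have bs : interlace beta s.
  split; first by rewrite szb.
  by rewrite szb => i /betaP[/andP].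
exists beta => //.
have := @all_roots_prod_XsubC _ q beta; rewrite (monicP qmonic) scale1r; apply.
- by rewrite szb szq.
- by apply/(all_nthP 0) => i; rewrite szb => /betaP[].
- by rewrite uniq_rootsE lt_sorted_uniq // (interlace_sorted_inner bs).
Qed.

(** The point list is completed by one point far to the right, where the monic
    [q] is positive, and one far to the left, where [q] has the sign of its
    degree parity; [zeros_in_gaps] then applies to the completed list. *)
Lemma zeros_around (R : realType) (q : {poly R}) (s : seq R) :
    q \is monic -> size q = (size s).+2 -> sorted <%R s -> alternates (- q) s ->
  exists2 beta, interlace s beta & q = prod_XsubC beta.
Proof.
move=> qmonic szq s_sorted alt.
have [M0 posM] : exists M0, forall x, M0 <= x -> 0 < q.[x].
  have [|M0 hM] := @poly_pinfty_gt_lc _ q; first by rewrite (monicP qmonic).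
  by exists M0 => x /hM; rewrite (monicP qmonic); apply: lt_le_trans.
have [L0 negL] : exists L0, forall x, x <= L0 -> 0 < (-1) ^+ (size s).+1 * q.[x].
  (* Reflecting the variable turns the sign at -oo into the sign at +oo. *)
  pose q' := (-1) ^+ (size s).+1 *: (q \Po (- 'X)).
  have lc : lead_coef q' = 1.
    rewrite lead_coefZ lead_coef_comp ?size_polyN ?size_polyX //.
    rewrite lead_coefN lead_coefX (monicP qmonic) szq /= mul1r.
    by rewrite -expr2 sqrr_sign.
  have [|M hM] := @poly_pinfty_gt_lc _ q'; first by rewrite lc.
  exists (- M) => x; rewrite lerNr => /hM; rewrite lc => /(lt_le_trans ltr01).
  by rewrite hornerZ horner_comp !hornerE opprK.
(* The second entry of each bound keeps the completed list increasing. *)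
pose L := Num.min L0 (head 0 s - 1).
pose M := Num.max M0 (last L s + 1).
pose s1 := L :: rcons s M.
have szs1 : size s1 = (size s).+2 by rewrite /= size_rcons.
have s1_sorted : sorted <%R s1.
  rewrite /= rcons_path; apply/andP; split; last first.
    by rewrite lt_max ltrDl ltr01 orbT.
  have : L < head 0 s by rewrite gt_min; apply/orP; right; rewrite ltrBlDr ltrDl.
  by case: (s) s_sorted => //= x s0 -> ->.
have s1E i : (i < size s)%N -> s1`_i.+1 = s`_i by move=> lti; rewrite /= nth_rcons lti.
have alt1 : alternates q s1.
  move=> i; rewrite szs1; case: i => [_|i].
    rewrite addn1 !exprS mulN1r mulN1r opprK -exprS.
    by apply: negL; rewrite ge_min lexx.
  rewrite ltnS ltnS leq_eqVlt => /orP[/eqP ->|lti].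
    rewrite /= nth_rcons ltnn eqxx -signr_odd oddD /= !negbK addbb expr0 mul1r.
    by apply: posM; rewrite le_max lexx.
  rewrite s1E // addnS !addSn !exprS !mulN1r opprK mulNr -mulrN -hornerN.
  exact: alt.
have [|beta [szb hb] ->] := zeros_in_gaps qmonic _ s1_sorted alt1; first by rewrite szs1.
exists beta => //; have szbs : size beta = (size s).+1.
  by move: szb; rewrite szs1 => -[].
split=> // i lti; rewrite -s1E //; split.
- by apply: (proj2 (hb i _)); rewrite szbs ltnW.
- by apply: (proj1 (hb i.+1 _)); rewrite szbs.
Qed.

(** * Polynomials given by a three-term recurrence *)

Lemma monic_recurrence (R : realType) (b l : nat -> R) (P : nat -> {poly R}) :
    P 0%N = 1 -> P 1%N = 'X - (b 0%N)%:P ->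
    (forall n, P n.+2 = ('X - (b n.+1)%:P) * P n.+1 - l n *: P n) ->
  forall n, P n \is monic /\ size (P n) = n.+1.
Proof.
move=> P0 P1 Prec.
suff H n : (P n \is monic /\ size (P n) = n.+1) /\
           (P n.+1 \is monic /\ size (P n.+1) = n.+2) by move=> n; case: (H n).
elim: n => [|n [[mon0 sz0] [mon1 sz1]]].
  by rewrite P0 P1 monic1 size_poly1 monicXsubC size_XsubC.
rewrite Prec; set M := _ * _; split=> //.
have monM : M \is monic by rewrite monicMl // monicXsubC.
have szM : size M = n.+3.
  by rewrite size_monicM ?monicXsubC ?monic_neq0 // size_XsubC sz1.
have lt_sz : (size (- (l n *: P n)) < size M)%N.
  by rewrite szM size_polyN (leq_ltn_trans (size_scale_leq _ _)) // sz0.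
by rewrite size_polyDl // szM monicE lead_coefDl // (monicP monM).
Qed.

(** At a zero of [P n.+1] the recurrence reads [P n.+2 = - l n *: P n], so the
    alternation of [P n] along these zeros is inherited by [- P n.+2], whose
    zeros then surround them; this is the interlacing of consecutive orthogonal
    polynomials. *)
Lemma alternates_monic_recurrence (R : realType) (b l : nat -> R)
    (P : nat -> {poly R}) :
    P 0%N = 1 -> P 1%N = 'X - (b 0%N)%:P ->
    (forall n, P n.+2 = ('X - (b n.+1)%:P) * P n.+1 - l n *: P n) ->
    (forall n, 0 < l n) ->
  forall n, exists s, [/\ size s = n.+1, sorted <%R s,
                          P n.+1 = prod_XsubC s & alternates (P n) s].
Proof.
move=> P0 P1 Prec lpos; have PM := monic_recurrence P0 P1 Prec.
elim=> [|n [s [szs s_sorted Ps alt]]].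
  exists [:: b 0%N]; split=> //; first by rewrite /prod_XsubC big_seq1.
  by case=> // _; rewrite P0 hornerC mulr1 /= expr2 mulrNN mulr1 ltr01.
have [mon2 sz2] := PM n.+2.
have [||s' ss' Ps'] := zeros_around mon2 _ s_sorted; first by rewrite sz2 szs.
  move=> i lti; rewrite Prec hornerN hornerD hornerM hornerN hornerZ.
  have -> : (P n.+1).[s`_i] = 0.
    by apply/rootP; rewrite Ps root_prod_XsubC mem_nth.
  rewrite mulr0 add0r opprK mulrCA mulr_gt0 //.
  exact: alt.
exists s'; split=> //; first by rewrite (proj1 ss') szs.
  exact: interlace_sorted_outer ss'.
by rewrite Ps; apply: alternates_prod_inner.
Qed.

(** The inverse of the leading coefficient of the n-th polynomial of the
    recurrence. *)
Definition inv_lead_coef (R : realType) (a : nat -> R) (n : nat) : R :=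
  \prod_(i < n) a i.

Lemma inv_lead_coef_neq0 (R : realType) (a : nat -> R) (n : nat) :
  (forall n, a n != 0) -> inv_lead_coef a n != 0.
Proof. by move=> a0; apply/prodf_neq0 => i _. Qed.

(** Rescaling turns [c n.+1] into [a n * c n.+1], which is why positivity of this
    product is the relevant hypothesis. *)
Lemma monic_three_term_recurrence (R : realType) (a b c : nat -> R)
    (p : nat -> {poly R}) (P := fun n => inv_lead_coef a n *: p n) :
    three_term_recurrence a b c p ->
  [/\ P 0%N = 1, P 1%N = 'X - (b 0%N)%:P &
      forall n, P n.+2 = ('X - (b n.+1)%:P) * P n.+1 - (a n * c n.+1) *: P n].
Proof.
move=> [p0 prec]; rewrite /P /inv_lead_coef; split.
- by rewrite big_ord0 scale1r.
- have := prec 0%N; rewrite p0 mulr1 addr0 big_ord1 => ->.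
  by rewrite alg_polyC addrK.
move=> n; have := prec n.+1; rewrite 2!big_ord_recr /=.
move: (\prod_(i < n) a i) => A E.
have -> : ('X - (b n.+1)%:P) * ((A * a n) *: p n.+1) =
          (A * a n) *: ('X * p n.+1) - (A * a n * b n.+1) *: p n.+1.
  by rewrite -!mul_polyC !polyCM; ring.
by rewrite E -!mul_polyC !polyCM; ring.
Qed.

(** * From factorisations to zeros *)

Lemma real_simple_zeros_prod (R : realType) (k : R) (s : seq R) :
  k != 0 -> sorted <%R s -> real_simple_zeros (k *: prod_XsubC s).
Proof.
move=> k0 s_sorted; rewrite /real_simple_zeros /= => z.
rewrite /prod_XsubC map_polyZ map_prod_XsubC.
have k0' : real_complex R k != 0 by rewrite fmorph_eq0.
rewrite -mul_polyC mupMr ?rootC // rootM rootC (negPf k0') /=.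
rewrite -(big_map (real_complex R) xpredT (fun y => 'X - y%:P)).
rewrite root_prod_XsubC mu_prod_XsubC => zs.
split; first by case/mapP: zs => x _ ->; rewrite complex_real.
rewrite count_uniq_mem ?zs // map_inj_uniq ?lt_sorted_uniq //.
exact: fmorph_inj.
Qed.

Lemma increasing_zeros_prod (R : realType) (k : R) (s : seq R) :
  k != 0 -> sorted <%R s -> increasing_zeros (k *: prod_XsubC s) s.
Proof. by move=> k0 s_sorted; split=> // x; rewrite rootZ // root_prod_XsubC. Qed.

(** * Large values of the parameter *)

Lemma eventually_all (R : realType) (n : nat) (G : nat -> R -> Prop) :
    (forall i, (i < n)%N -> exists T, forall t, T < t -> G i t) ->
  exists2 T, 0 < T & forall t, T < t -> forall i, (i < n)%N -> G i t.
Proof.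
elim: n => [_|n IH evG]; first by exists 1; rewrite ?ltr01.
have [T Tpos hT] := IH (fun i lti => evG i (leqW lti)).
have [T' hT'] := evG n (ltnSn n).
exists (Num.max T T'); first by rewrite lt_max Tpos.
move=> t; rewrite gt_max => /andP[ltT ltT'] i.
by rewrite ltnS leq_eqVlt => /orP[/eqP -> | lti]; [apply: hT' | apply: hT].
Qed.

Lemma size_lincomb (R : realType) (k : nat -> R) (p : nat -> {poly R}) (m : nat) :
    (forall n, size (p n) = n.+1) -> (size (\sum_(n < m) k n *: p n)%R <= m)%N.
Proof.
move=> szp; elim/big_ind: _ => [|q r hq hr|i _].
- by rewrite size_poly0.
- by rewrite (leq_trans (size_polyD _ _)) // geq_max hq.
- by rewrite (leq_trans (size_scale_leq _ _)) // szp.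
Qed.

(** With the point fixed, the value of [genpoly alpha p N t] is a polynomial in
    [t] whose leading coefficient is [alpha N] times the value of [p N]; so its
    sign is eventually that of the latter, up to the sign of [alpha N]. *)
Lemma eventually_alternates_genpoly (R : realType) (alpha : nat -> R)
    (p : nat -> {poly R}) (N : nat) (A : R) (s : seq R) :
    alpha N != 0 -> alternates (A *: p N) s ->
  exists2 T, 0 < T & forall t, T < t ->
    alternates ((A / (t ^+ N * alpha N)) *: genpoly alpha p N t) s.
Proof.
move=> al0 alt.
have [i lti|T Tpos hT] := @eventually_all R (size s) (fun i t => 0 < t ->
    0 < (-1) ^+ (size s + i.+1) *
        ((A / (t ^+ N * alpha N)) *: genpoly alpha p N t).[s`_i]); last first.
  by exists T => // t ltt i lti; apply: hT => //; apply: lt_trans ltt.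
pose e : R := (-1) ^+ (size s + i.+1).
(* The polynomial in the parameter, signed so as to be eventually positive. *)
pose F := (e * A / alpha N) *: \poly_(n < N.+1) (alpha n * (p n).[s`_i]).
have lcF : 0 < lead_coef F.
  have := alt i lti; rewrite -/e hornerZ => pos.
  have px0 : (p N).[s`_i] != 0 by apply: contraTneq pos => ->; rewrite !mulr0 ltxx.
  rewrite lead_coefZ lead_coef_poly ?mulf_neq0 //=.
  by rewrite mulrA divfK // -mulrA.
have [T hT] := poly_pinfty_gt_lc lcF.
exists T => t ltt tpos; rewrite -/e.
have Fpos : 0 < F.[t] by apply: lt_le_trans lcF (hT _ (ltW ltt)).
suff -> : e * ((A / (t ^+ N * alpha N)) *: genpoly alpha p N t).[s`_i]
          = F.[t] / t ^+ N by rewrite divr_gt0 // exprn_gt0.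
have -> : F.[t] = e * A / alpha N * (genpoly alpha p N t).[s`_i].
  rewrite hornerZ horner_poly horner_sum; congr (_ * _); apply: eq_bigr => n _.
  by rewrite hornerZ; ring.
rewrite hornerZ; field.
by rewrite al0 expf_neq0 // lt0r_neq0.
Qed.

Theorem proposition3p1 (R : realType) (a b c : nat -> R)
    (ha : forall n : nat, a n != 0)
    (hac : forall n : nat, (1 <= n)%N -> 0 < a n.-1 * c n)
    (p : nat -> {poly R}) (hp : three_term_recurrence a b c p)
    (alpha : nat -> R) (halpha : forall n : nat, alpha n != 0)
    (halpha0 : alpha 0%N = 1)
    (N : nat) (hN : (1 <= N)%N) :
  exists T : R, 0 < T /\
    forall t : R, T < t ->
      (size (genpoly alpha p N t) = N.+1 /\
       real_simple_zeros (genpoly alpha p N t)) /\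
      (real_simple_zeros (genpoly alpha p N.+1 t) /\
       exists beta beta' : seq R,
         size beta = N /\ size beta' = N.+1 /\
         increasing_zeros (genpoly alpha p N t) beta /\
         increasing_zeros (genpoly alpha p N.+1 t) beta' /\
         interlace beta beta').
Proof.
pose A := inv_lead_coef a; pose P n := A n *: p n.
have A0 n : A n != 0 by exact: inv_lead_coef_neq0.
have [P0 P1 Prec] := monic_three_term_recurrence hp.
have PM n : P n \is monic /\ size (P n) = n.+1 := monic_recurrence P0 P1 Prec n.
have szp n : size (p n) = n.+1 by rewrite -(size_scale _ (A0 n)); case: (PM n).
have [s [szs s_sorted Ps alt]] :=
  alternates_monic_recurrence P0 P1 Prec (fun n => hac n.+1 isT) N.
have [T Tpos hT] := eventually_alternates_genpoly (halpha N) alt.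
exists T; split=> // t ltt; have tpos := lt_trans Tpos ltt.
(* [k m] is the inverse of the leading coefficient of [genpoly alpha p m t]. *)
pose k m := A m / (t ^+ m * alpha m); pose Q m := k m *: genpoly alpha p m t.
have k0 m : k m != 0.
  by rewrite mulf_neq0 // invr_neq0 // mulf_neq0 // expf_neq0 // lt0r_neq0.
have genE m : genpoly alpha p m t = (k m)^-1 *: Q m.
  by rewrite scalerA mulVf // scale1r.
have QE m : Q m = P m + k m *: \sum_(n < m) (t ^+ n * alpha n) *: p n.
  rewrite /Q /genpoly big_ord_recr /= scalerDr addrC scalerA divfK //.
  by rewrite mulf_neq0 // expf_neq0 // lt0r_neq0.
have QM m : Q m \is monic /\ size (Q m) = m.+1.
  have [monP szP] := PM m; rewrite QE.
  set S := \sum_(n < m) _.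
  have lt_sz : (size (k m *: S) < size (P m))%N.
    rewrite szP ltnS (leq_trans (size_scale_leq _ _)) //.
    exact: (size_lincomb (fun n => t ^+ n * alpha n)).
  by rewrite size_polyDl // monicE lead_coefDl // (monicP monP).
have [monN szN] := QM N; have [monN1 szN1] := QM N.+1.
have [|beta bs Qb] := zeros_in_gaps monN _ s_sorted (hT t ltt).
  by rewrite szN szs.
have szb : size beta = N by move: (proj1 bs); rewrite szs => -[].
have b_sorted := interlace_sorted_inner bs.
(* [Q N.+1] and [P N.+1] agree on [beta], as they differ by a multiple of [Q N]. *)
have altN1 : alternates (- Q N.+1) beta.
  move=> i lti; have := alternates_prod_outer bs lti.
  suff -> : (- Q N.+1).[beta`_i] = (- prod_XsubC s).[beta`_i] by [].
  have /rootP b0 : root (prod_XsubC beta) beta`_i.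
    by rewrite root_prod_XsubC mem_nth.
  rewrite -Ps !hornerN QE -/(genpoly alpha p N t) genE Qb scalerA hornerD.
  by rewrite [X in _ + X]hornerZ b0 mulr0 addr0.
have [|beta' bb' Qb'] := zeros_around monN1 _ b_sorted altN1.
  by rewrite szN1 szb.
have b'_sorted := interlace_sorted_outer bb'.
have kV0 m : (k m)^-1 != 0 by rewrite invr_eq0.
split; first split.
- by rewrite genE size_scale.
- by rewrite genE Qb; apply: real_simple_zeros_prod.
split; first by rewrite genE Qb'; apply: real_simple_zeros_prod.
exists beta, beta'; split=> //; split; first by rewrite (proj1 bb') szb.
rewrite !genE Qb Qb'; split; first exact: increasing_zeros_prod.
by split=> //; apply: increasing_zeros_prod.
Qed.
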